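(* The integrality gap of the semidefinite program $\mathrm{SDP}_2$ (the symmetry-reduced QAP relaxation of the traveling salesman problem defined in the context) is unbounded; that is, $$\sup_{D\in\mathcal{D}} \frac{\mathrm{OPT}_{\mathrm{TSP}}(D)}{\mathrm{OPT}_{\mathrm{SDP}_2}(D)}=+\infty .$$
   Context: TSP: an instance on $N$ vertices is a symmetric matrix $D=(d_{ij})\in\mathbb{R}^{N\times N}$ with $d_{ij}\ge 0$, $d_{ii}=0$ and $d_{ij}\le d_{ik}+d_{kj}$ for all $i,j,k$ (distinct vertices may be at distance $0$). $\mathcal{D}$ is the set of all such matrices, over all $N\ge 3$. $\mathrm{OPT}_{\mathrm{TSP}}(D)$ is the minimum total cost of a Hamiltonian cycle in the complete graph $K_N$ with edge costs $d_{ij}$. Notation: $[m]=\{1,\dots,m\}$; $I_m$, $J_m$ are the $m\times m$ identity and all-ones matrices; $E^{(m)}_{jj}$ is the $m\times m$ matrix with a single $1$ in position $(j,j)$; $\mathbb{S}^{m\times m}$ is the set of real symmetric $m\times m$ matrices; $M[S,T]$ is the submatrix of $M$ with rows in $S$ and columns in $T$, and $M[S]=M[S,S]$; $\mathrm{Diag}(x)$ is the diagonal matrix with diagonal $x$; $\mathrm{vec}(M)$ stacks the columns of $M$; $\otimes$ is the Kronecker product; $Y\ge 0$ is entrywise nonnegativity and $Y\succeq 0$ is positive semidefiniteness. $C^{(N)}_1$ is the adjacency matrix of the $N$-cycle on $[N]$ with edges $\{i,i+1\}$ and $\{N,1\}$. $\mathrm{SDP}_2$: for an $N$-vertex instance $D$,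 put $n=N-1$, fix $r,s\in[n+1]$, and let $\alpha=[n+1]\setminus\{r\}$, $\beta=[n+1]\setminus\{s\}$, $\bar c=\mathrm{vec}\big(C^{(n+1)}_1[\alpha,\{r\}]\,D[\{s\},\beta]\big)\in\mathbb{R}^{n^2}$. Then $\mathrm{OPT}_{\mathrm{SDP}_2}(D)$ is the minimum of $$\mathrm{trace}\Big(\big(D[\beta]\otimes \tfrac12 C^{(n+1)}_1[\alpha]+\mathrm{Diag}(\bar c)\big)Y\Big)$$ over $Y\in\mathbb{S}^{n^2\times n^2}$ with $Y\ge 0$, $Y\succeq 0$ and (i) $\mathrm{trace}((I_n\otimes E^{(n)}_{jj})Y)=1$ for $j=1,\dots,n$; (ii) $\mathrm{trace}((E^{(n)}_{jj}\otimes I_n)Y)=1$ for $j=1,\dots,n$; (iii) $\mathrm{trace}\big((I_n\otimes(J_n-I_n)+(J_n-I_n)\otimes I_n)Y\big)=0$; (iv) $\mathrm{trace}((J_n\otimes J_n)Y)=n^2$. The choice of $r,s$ for each $N$ is arbitrary but fixed (one may take $r=s=1$). In the supremum, instances with $\mathrm{OPT}_{\mathrm{TSP}}(D)=0$ are disregarded, and a ratio with positive numerator and zero denominator is read as $+\infty$. *)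

(* Defs.v *)
From mathcomp Require Import all_boot all_order all_fingroup all_algebra.
From mathcomp Require Import all_classical all_reals ereal.
From mathcomp.real_closed Require Import mxtens.

Set Implicit Arguments.
Unset Strict Implicit.
Unset Printing Implicit Defensive.

Import Order.TTheory GRing.Theory Num.Theory.

Local Open Scope ring_scope.

(** Instances of the traveling salesman problem and their optimal value *)

Definition tsp_instance (R : realType) (N : nat) (D : 'M[R]_N) : Prop :=
  [/\ forall i j, D i j = D j i,
      forall i j, 0 <= D i j,
      forall i, D i i = 0
    & forall i j k, D i j <= D i k + D k j].

(* For 3 <= N, the Hamiltonian cycles of K_N are the cycles through the
   vertices s 0, s 1, ..., s (N - 1) and back to s 0, for s a permutation. *)
Definition tour_cost (R : realType) (N : nat) (D : 'M[R]_N) (s : 'S_N) : R :=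
  \sum_(i < N) D (s i) (s (ordS i)).

Definition OPT_TSP (R : realType) (N : nat) (D : 'M[R]_N) : R :=
  tour_cost D [arg min_(s < 1%g : 'S_N) tour_cost D s]%O.

(** The semidefinite program *)

Definition cycle_mx (R : realType) (N : nat) : 'M[R]_N :=
  \matrix_(i, j) ((j == ordS i) || (i == ordS j))%:R.

(* mxvec concatenates the rows of a matrix, so the transpose makes vec stack
   the columns of M; vecE below checks that this is compatible with the
   indexing of the Kronecker product *t. *)
Definition vec (R : realType) (m n : nat) (M : 'M[R]_(m, n)) : 'rV[R]_(n * m) :=
  mxvec M^T.

Definition psdmx (R : realType) (m : nat) (Y : 'M[R]_m) : Prop :=
  forall x : 'cV[R]_m, 0 <= (x^T *m Y *m x) 0 0.

(* The scalar a%:M is the multiple a I_n of the identity, const_mx 1 is the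
   all-ones matrix J_n, and delta_mx j j is E_jj. *)
Definition sdp2_feasible (R : realType) (n : nat) (Y : 'M[R]_(n * n)) : Prop :=
  let I : 'M[R]_n := 1%:M in
  let J : 'M[R]_n := const_mx 1 in
  [/\ Y^T = Y, (forall k l, 0 <= Y k l) & psdmx Y] /\
  [/\ forall j : 'I_n, \tr ((I *t delta_mx j j) *m Y) = 1,
      forall j : 'I_n, \tr ((delta_mx j j *t I) *m Y) = 1,
      \tr ((I *t (J - I) + (J - I) *t I) *m Y) = 0
    & \tr ((J *t J) *m Y) = n%:R ^+ 2].

(* row' s and col' s delete row s and column s, hence for instance
   row' s (col' s D) is D[beta] with beta the complement of {s}. *)
Definition sdp2_cost (R : realType) (n : nat) (r s : 'I_n.+1)
    (D : 'M[R]_n.+1) : 'M[R]_(n * n) :=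
  let C : 'M[R]_n.+1 := cycle_mx R n.+1 in
  let Dbeta : 'M[R]_n := row' s (col' s D) in
  let Calpha : 'M[R]_n := row' r (col' r C) in
  let c : 'rV[R]_(n * n) :=
    vec ((col r (row' r C) : 'cV[R]_n) *m (row s (col' s D) : 'rV[R]_n)) in
  Dbeta *t (2^-1 *: Calpha) + diag_mx c.

(* The feasible set is compact (by nonnegativity and the last trace
   constraint) and nonempty, so that this infimum is a minimum. *)
Definition OPT_SDP2 (R : realType) (n : nat) (r s : 'I_n.+1)
    (D : 'M[R]_n.+1) : \bar R :=
  ereal_inf [set (\tr (sdp2_cost r s D *m Y))%:E |
             Y in [set Y | sdp2_feasible Y]]%classic.

(* An instance on N >= 3 vertices is indexed by n = N - 1 >= 2; r and s choose
   the deleted vertices for each n. In \bar R, the inverse of 0 is +oo. *)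
Definition sdp2_integrality_gap (R : realType) (r s : forall n, 'I_n.+1) :
    \bar R :=
  ereal_sup [set q | exists (n : nat) (D : 'M[R]_n.+1),
    [/\ (2 <= n)%N, tsp_instance D, OPT_TSP D != 0
      & q = ((OPT_TSP D)%:E / OPT_SDP2 (r n) (s n) D)%E]]%classic.

(** Sanity checks *)

Lemma OPT_TSP_le (R : realType) (N : nat) (D : 'M[R]_N) (s : 'S_N) :
  OPT_TSP D <= tour_cost D s.
Proof. by rewrite /OPT_TSP; case: arg_minP => // t _; apply. Qed.

Lemma index_allpairs (S T : eqType) (s : seq S) (t : seq T) x y :
  x \in s -> y \in t ->
  index (x, y) [seq (a, b) | a <- s, b <- t]
    = (index x s * size t + index y t)%N.
Proof.
move=> + yt; elim: s => //= a s IH; rewrite inE index_cat size_map.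
have [<- _|ax /= xs] := eqVneq x a.
  by rewrite map_f // index_map // => b c [].
rewrite IH //; case: ifP => [/mapP[b _ [xa _]]|_].
  by rewrite xa eqxx in ax.
by rewrite mulSn addnA.
Qed.

Lemma mxvec_tens_index (m n : nat) (i : 'I_m) (j : 'I_n) :
  mxvec_index i j = mxtens_index (i, j).
Proof.
apply/val_inj => /=.
rewrite /enum_rank; rewrite [enum_rank_in]unlock insubdK; last first.
  by rewrite -[_ \in _]/(_ < _)%N cardE index_mem mem_enum.
by rewrite enumT unlock /= /prod_enum index_allpairs ?mem_enum //
   size_enum_ord !index_enum_ord.
Qed.

Lemma vecE (R : realType) (m n : nat) (M : 'M[R]_(m, n)) i j :
  vec M 0 (mxtens_index (j, i)) = M i j.
Proof. by rewrite -mxvec_tens_index mxvecE mxE. Qed.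

(* Main.v *)
(** Take the cut metric of a set B of b vertices avoiding s: distance 1 across
    the cut and 0 otherwise, so that every tour costs at least 1.  The program
    only sees pairwise marginals, so a feasible Y is obtained from a positive
    semidefinite kernel T on the n positions with unit diagonal, entries in
    [0, 1] and row sums b: read T i j as the probability that position j is
    occupied by B given that i is, with B uniform over the positions, and share
    these probabilities uniformly inside B and inside its complement.  The cost
    of Y is at most 2 b (1 - T i (i+1)) + 2 b / n.  For T the autocorrelation
    on the cycle of an indicator of an interval (an honest tour) the first term
    is 2, but for the autocorrelation of a continuous bump of width b, here
    k (b - k), it is O(1/b), and n of order b^2 makes the second one O(1/b)
    too. *)

Require Import Defs.
From mathcomp Require Import all_boot all_order all_fingroup all_algebra.
From mathcomp Require Import all_classical all_reals ereal.
From mathcomp.real_closed Require Import mxtens.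
From mathcomp Require Import ring lra zify.

Set Implicit Arguments.
Unset Strict Implicit.
Unset Printing Implicit Defensive.

Import Order.TTheory GRing.Theory Num.Theory.

Local Open Scope ring_scope.

(** * Bilinear forms and positive semidefinite matrices *)

Definition bform (R : realType) (n : nat) (M : 'M[R]_n) (u w : 'cV[R]_n) : R :=
  (u^T *m M *m w) 0 0.

Section BilinearForm.
Context {R : realType} {n : nat}.
Implicit Types (M : 'M[R]_n) (u w : 'cV[R]_n).

Lemma bformE M u w : bform M u w = \sum_i \sum_j M i j * (u i 0 * w j 0).
Proof.
rewrite /bform mxE exchange_big /=; apply: eq_bigr => j _.
rewrite mxE mulr_suml; apply: eq_bigr => i _; rewrite !mxE; ring.
Qed.

Lemma bformDr M u w1 w2 : bform M u (w1 + w2) = bform M u w1 + bform M u w2.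
Proof. by rewrite /bform mulmxDr mxE. Qed.

Lemma bformDl M u1 u2 w : bform M (u1 + u2) w = bform M u1 w + bform M u2 w.
Proof. by rewrite /bform linearD !mulmxDl mxE. Qed.

Lemma bformZr M u w (c : R) : bform M u (c *: w) = c * bform M u w.
Proof. by rewrite /bform -scalemxAr mxE. Qed.

Lemma bformZl M u w (c : R) : bform M (c *: u) w = c * bform M u w.
Proof. by rewrite /bform linearZ /= -!scalemxAl mxE. Qed.

Lemma bformMD M1 M2 u w : bform (M1 + M2) u w = bform M1 u w + bform M2 u w.
Proof. by rewrite /bform mulmxDr mulmxDl mxE. Qed.

Lemma bformMZ M u w (c : R) : bform (c *: M) u w = c * bform M u w.
Proof. by rewrite /bform -scalemxAr -scalemxAl mxE. Qed.

Lemma bformNr M u w : bform M u (- w) = - bform M u w.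
Proof. by rewrite -scaleN1r bformZr mulN1r. Qed.

Lemma bformNl M u w : bform M (- u) w = - bform M u w.
Proof. by rewrite -scaleN1r bformZl mulN1r. Qed.

Lemma bformMN M u w : bform (- M) u w = - bform M u w.
Proof. by rewrite -scaleN1r bformMZ mulN1r. Qed.

Lemma bform_sumr (I : Type) (s : seq I) (P : pred I) M u (F : I -> 'cV[R]_n) :
  bform M u (\sum_(i <- s | P i) F i) = \sum_(i <- s | P i) bform M u (F i).
Proof. by rewrite /bform mulmx_sumr summxE. Qed.

Lemma bform_suml (I : Type) (s : seq I) (P : pred I) M w (F : I -> 'cV[R]_n) :
  bform M (\sum_(i <- s | P i) F i) w = \sum_(i <- s | P i) bform M (F i) w.
Proof. by rewrite /bform linear_sum !mulmx_suml summxE. Qed.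

Lemma bformC M u w : M^T = M -> bform M u w = bform M w u.
Proof.
move=> sM; rewrite !bformE exchange_big /=; apply: eq_bigr => i _.
by apply: eq_bigr => j _; rewrite -{1}sM mxE [u _ _ * _]mulrC.
Qed.

Lemma bform_const u w :
  bform (const_mx 1) u w = (\sum_i u i 0) * (\sum_i w i 0).
Proof.
rewrite bformE mulr_suml; apply: eq_bigr => i _.
by rewrite mulr_sumr; apply: eq_bigr => j _; rewrite mxE mul1r.
Qed.

Definition bform_lin := (bformMD, bformMN, bformMZ, bformDl, bformDr, bformNl,
  bformNr, bformZl, bformZr).

End BilinearForm.

Lemma psdmxZ (R : realType) (n : nat) (c : R) (M : 'M[R]_n) :
  0 <= c -> psdmx M -> psdmx (c *: M).
Proof. by move=> c0 pM x; rewrite -/(bform _ _ _) bformMZ mulr_ge0 // pM. Qed.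

Lemma psdmxD (R : realType) (n : nat) (M1 M2 : 'M[R]_n) :
  psdmx M1 -> psdmx M2 -> psdmx (M1 + M2).
Proof. by move=> p1 p2 x; rewrite -/(bform _ _ _) bformMD addr_ge0 ?p1 ?p2. Qed.

(* The form of [c%:M - M] at [u] is half the sum of [M i j * (u i - u j) ^+ 2].
   *)
Lemma psdmx_rowsum (R : realType) (n : nat) (M : 'M[R]_n) (c : R) :
  M^T = M -> (forall i j, 0 <= M i j) -> (forall i, \sum_j M i j = c) ->
  psdmx (c%:M - M).
Proof.
move=> sM M0 Mc u; rewrite -/(bform _ _ _).
have Mji i j : M j i = M i j by rewrite -{1}sM mxE.
have -> : bform (c%:M - M) u u
    = 2^-1 * \sum_i \sum_j M i j * (u i 0 - u j 0) ^+ 2.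
  have E : \sum_i \sum_j M i j * u i 0 ^+ 2 = \sum_i c * u i 0 ^+ 2.
    by apply: eq_bigr => i _; rewrite -mulr_suml Mc.
  have E' : \sum_i \sum_j M i j * u j 0 ^+ 2 = \sum_i c * u i 0 ^+ 2.
    rewrite exchange_big -E; apply: eq_bigr => i _.
    by apply: eq_bigr => j _; rewrite Mji.
  have -> : \sum_i \sum_j M i j * (u i 0 - u j 0) ^+ 2
     = \sum_i \sum_j M i j * u i 0 ^+ 2 + \sum_i \sum_j M i j * u j 0 ^+ 2
       - 2 * bform M u u.
    rewrite bformE mulr_sumr -!big_split -sumrB /=; apply: eq_bigr => i _.
    rewrite mulr_sumr -!big_split -sumrB /=; apply: eq_bigr => j _; ring.
  rewrite E E' bformMD bformMN -scalemx1 bformMZ.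
  have -> : bform 1%:M u u = \sum_i u i 0 ^+ 2.
    by rewrite /bform mulmx1 mxE; apply: eq_bigr => i _; rewrite mxE.
  by rewrite -mulr_sumr; field.
by apply: mulr_ge0 => //; apply: sumr_ge0 => i _; apply: sumr_ge0 => j _;
  rewrite mulr_ge0 ?sqr_ge0.
Qed.

(* Jensen's inequality for the positive semidefinite form of [1 - Q]. *)
Lemma bform_group (R : realType) (n : nat) (I : finType) (G : {set I})
    (Q : 'M[R]_n) (y : I -> 'cV[R]_n) (S : 'cV[R]_n) :
  (0 < #|G|)%N -> psdmx (1%:M - Q) -> S = \sum_(v in G) y v ->
  bform (#|G|%:R^-1 *: (1%:M - Q) + Q) S S <=
  \sum_(v in G) \sum_(w in G) bform (if v == w then 1%:M else Q) (y v) (y w).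
Proof.
move=> G0 pQ Sy; set g : R := #|G|%:R.
have g0 : g != 0 by rewrite pnatr_eq0 -lt0n.
have E v : v \in G -> \sum_(w in G) bform (if v == w then 1%:M else Q) (y v) (y
  w)
   = bform (1%:M - Q) (y v) (y v) + bform Q (y v) S.
  move=> Gv; rewrite Sy bform_sumr (bigD1 v) //= eqxx [X in _ = _ + X](bigD1 v)
    //=.
  rewrite (eq_bigr (fun w => bform Q (y v) (y w))); last first.
    by move=> w /andP[_ wv]; rewrite eq_sym (negbTE wv).
  rewrite bformMD bformMN; ring.
rewrite (eq_bigr _ E) big_split /= -bform_suml -Sy bformMD lerD2r.
set P := 1%:M - Q in pQ *.
(* The [y v - g^-1 *: S] are the deviations from the mean, so expanding this sum gives the sum of
   the forms of [P] at the [y v] minus [g^-1] times its form at [S]. *)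
have : 0 <= \sum_(v in G) bform P (y v - g^-1 *: S) (y v - g^-1 *: S).
  by apply: sumr_ge0 => v _; apply: pQ.
rewrite (eq_bigr (fun v => bform P (y v) (y v) - g^-1 * bform P (y v) S
    - g^-1 * bform P S (y v) + g^-1 ^+ 2 * bform P S S)); last first.
  by move=> v _; rewrite !bform_lin; ring.
rewrite !big_split /= !sumrN -!mulr_sumr -bform_suml -bform_sumr -Sy.
rewrite sumr_const -/g -mulr_natr -/g bformMZ.
have -> : g^-1 ^+ 2 * (bform P S S * g) = g^-1 * bform P S S by field.
lra.
Qed.

(** * Overlap kernels *)

(* [T i j] plays the role of the conditional probability that position [j] is
   occupied by a vertex of B, given that position [i] is. *)
Definition overlap_kernel (R : realType) (n b : nat) (T : 'M[R]_n) : Prop :=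
  [/\ T^T = T, psdmx T, forall i, T i i = 1, forall i j, 0 <= T i j <= 1
    & forall i, \sum_j T i j = b%:R].

(** By the row sums, the all-ones vector is an eigenvector of [T] for the eigenvalue [b].
    Subtracting from [u] its component along that vector lowers the form by exactly the left-hand
    side, and what remains is nonnegative. *)
Lemma overlap_kernel_mean (R : realType) (n b : nat) (T : 'M[R]_n)
    (u : 'cV[R]_n) :
  overlap_kernel b T -> b%:R / n%:R * (\sum_i u i 0) ^+ 2 <= bform T u u.
Proof.
case=> sT pT _ _ Tb; case: n T u sT pT Tb => [|n] T u sT pT Tb.
  by rewrite invr0 mulr0 mul0r; apply: pT.
set t := \sum_i u i 0; set N : R := n.+1%:R.
have N0 : N != 0 by rewrite pnatr_eq0.
have E w : bform T w (const_mx 1) = b%:R * \sum_i w i 0.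
  rewrite bformE mulr_sumr; apply: eq_bigr => i _.
  by rewrite -(Tb i) mulr_suml; apply: eq_bigr => j _; rewrite mxE mulr1.
have := pT (u - (t / N) *: const_mx 1); rewrite -/(bform _ _ _).
rewrite !bform_lin (bformC _ u sT) !E -/t.
have -> : \sum_(i < n.+1) (const_mx 1 : 'cV[R]_n.+1) i 0 = N.
  under eq_bigr do rewrite mxE.
  by rewrite sumr_const card_ord.
move: (bform T u u) => q.
have -> : q + - (t / N * (b%:R * t)) + (- (t / N * (b%:R * t))
    - (t / N) * - (t / N * (b%:R * N))) = q - b%:R / N * t ^+ 2 by field.
by rewrite subr_ge0.
Qed.

(** * Sums and traces over Kronecker indices *)

Lemma big_mxtens (R : nmodType) (m n : nat) (F : 'I_(m * n) -> R) :
  \sum_k F k = \sum_i \sum_j F (mxtens_index (i, j)).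
Proof.
rewrite pair_big (reindex (@mxtens_index m n)) /=.
  by apply: eq_bigr => -[].
by exists (@mxtens_unindex m n) => k _; rewrite (mxtens_indexK,
  mxtens_unindexK).
Qed.

Lemma mxtrace_mxtens (R : comPzSemiRingType) (m n : nat) (A Y : 'M[R]_(m * n)) :
  \tr (A *m Y) = \sum_v \sum_i \sum_w \sum_j
    A (mxtens_index (v, i)) (mxtens_index (w, j)) *
    Y (mxtens_index (w, j)) (mxtens_index (v, i)).
Proof.
rewrite /mxtrace big_mxtens; apply: eq_bigr => v _; apply: eq_bigr => i _.
by rewrite mxE big_mxtens.
Qed.

(** * The feasible solution built from an overlap kernel *)

Section CutSolution.
Context {R : realType} {n : nat}.
Variables (B : {set 'I_n}) (T : 'M[R]_n).

Let b : R := #|B|%:R.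
Let a : R := #|~: B|%:R.

(** Given a vertex of B at position i, position j is occupied by B with probability [T i j]:
    removing that vertex itself leaves [T - 1%:M], shared by [b - 1] vertices, while [1 - T i j] is
    shared by the [a] vertices outside. Given instead a vertex outside B at i, Bayes' rule with B of
    density b/n gives the probability (a - b + b T i j) / a that j is outside as well. Removing the
    identity and sharing among [a - 1] vertices yields [out_block]. *)
Definition in_block : 'M[R]_n := (b - 1)^-1 *: (T - 1%:M).

Definition out_block : 'M[R]_n :=
  (a * (a - 1))^-1 *: ((a - b) *: const_mx 1 + b *: T - a *: 1%:M).

Definition cross_block : 'M[R]_n := a^-1 *: (const_mx 1 - T).

(* Up to the factor 1/n, position [(v, i), (w, j)] of the solution: the
   pseudo-probability that [v] is at position [i] and [w] at position [j]. *)
Definition cut_block (v w : 'I_n) : 'M[R]_n :=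
  if v == w then 1%:M else
  if v \in B then if w \in B then in_block else cross_block
  else if w \in B then cross_block else out_block.

Definition cut_solution : 'M[R]_(n * n) :=
  \matrix_(k, l) (n%:R^-1 *
    cut_block (mxtens_unindex k).1 (mxtens_unindex l).1
      (mxtens_unindex k).2 (mxtens_unindex l).2).

Hypotheses (kerT : overlap_kernel #|B| T) (b2 : (2 <= #|B|)%N)
  (leba : (#|B| <= #|~: B|)%N).

Let sT : T^T = T. Proof. by case: kerT. Qed.
Let Tb i : \sum_j T i j = b. Proof. by case: kerT. Qed.
Let T01 i j : 0 <= T i j <= 1. Proof. by case: kerT. Qed.
Let Tii i : T i i = 1. Proof. by case: kerT. Qed.
Let b2R : 2 <= b. Proof. by rewrite ler_nat. Qed.
Let lebaR : b <= a. Proof. by rewrite ler_nat. Qed.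
Let nE : n%:R = a + b :> R.
Proof. by rewrite -natrD addnC cardsC card_ord. Qed.
Let a0 : a != 0. Proof. by apply/lt0r_neq0; move: b2R lebaR; lra. Qed.
Let a1 : a - 1 != 0. Proof. by apply/lt0r_neq0; move: b2R lebaR; lra. Qed.
Let b0 : b != 0. Proof. by apply/lt0r_neq0; move: b2R; lra. Qed.
Let b1 : b - 1 != 0. Proof. by apply/lt0r_neq0; move: b2R; lra. Qed.
Let n0 : a + b != 0. Proof. by apply/lt0r_neq0; move: b2R lebaR; lra. Qed.

(** This and [psd_out] are the hypotheses of [bform_group]. Each difference is a positive multiple
    of c I - M, with M symmetric, nonnegative and of constant row sum c. *)
Let psd_in : psdmx (1%:M - in_block).
Proof.
have -> : 1%:M - in_block = (b - 1)^-1 *: (b%:M - T).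
  by apply/matrixP => i j; rewrite !mxE -[b *+ _]mulr_natr; field.
apply: psdmxZ; first by rewrite invr_ge0; move: b2R; lra.
by apply: psdmx_rowsum => // i j; case/andP: (T01 i j).
Qed.

Let psd_out : psdmx (1%:M - out_block).
Proof.
set M : 'M[R]_n := (a - b) *: const_mx 1 + b *: T.
have -> : 1%:M - out_block = (a * (a - 1))^-1 *: ((a ^+ 2)%:M - M).
  apply/matrixP => i j; rewrite !mxE -[a ^+ 2 *+ _]mulr_natr; field.
  by rewrite a0 a1.
apply: psdmxZ; first by rewrite invr_ge0 mulr_ge0 //; move: b2R lebaR; lra.
(* The entries of [M] are nonnegative because [b <= a], and its row sums are (a - b)(a + b) + b^2 =
   a^2. *)
apply: psdmx_rowsum => [|i j|i].
- by rewrite /M linearD !linearZ /= sT trmx_const.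
- rewrite !mxE; case/andP: (T01 i j) => T0 _.
  by rewrite addr_ge0 ?mulr_ge0 ?mulr1 //; move: b2R lebaR; lra.
under eq_bigr do rewrite !mxE.
rewrite big_split /= -mulr_sumr -mulr_sumr Tb sumr_const card_ord nE; ring.
Qed.

Let sym_in : in_block^T = in_block.
Proof. by rewrite /in_block linearZ linearB /= sT trmx1. Qed.

Let sym_out : out_block^T = out_block.
Proof.
by rewrite /out_block linearZ linearB linearD !linearZ /= sT trmx1 trmx_const.
Qed.

Let sym_cross : cross_block^T = cross_block.
Proof. by rewrite /cross_block linearZ linearB /= sT trmx_const. Qed.

Let cut_blockC v w : cut_block v w = cut_block w v.
Proof. by rewrite /cut_block eq_sym; do !case: ifP. Qed.

Let sym_cut v w : (cut_block v w)^T = cut_block v w.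
Proof. by rewrite /cut_block; do !case: ifP => _ //; rewrite trmx1. Qed.

(** Jensen inside B and inside its complement replaces the family [y] by the two sums [SB] and [SA].
    The form in these two vectors that remains is a square plus a multiple of the gap in
    [overlap_kernel_mean]. *)
Lemma cut_block_form_ge0 (y : 'I_n -> 'cV[R]_n) :
  0 <= \sum_v \sum_w bform (cut_block v w) (y v) (y w).
Proof.
pose SB := \sum_(v in B) y v; pose SA := \sum_(v in ~: B) y v.
have splitB (F : 'I_n -> R) : \sum_v F v = \sum_(v in B) F v + \sum_(v in ~: B)
  F v.
  rewrite (bigID (mem B)) /=; congr (_ + _).
  by apply: eq_bigl => v; rewrite inE.
have -> : \sum_v \sum_w bform (cut_block v w) (y v) (y w)
   = \sum_(v in B) \sum_(w in B)
       bform (if v == w then 1%:M else in_block) (y v) (y w)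
   + \sum_(v in ~: B) \sum_(w in ~: B)
       bform (if v == w then 1%:M else out_block) (y v) (y w)
   + 2 * bform cross_block SB SA.
  have E1 : \sum_(v in B) \sum_(w in ~: B) bform (cut_block v w) (y v) (y w)
     = bform cross_block SB SA.
    rewrite bform_suml; apply: eq_bigr => v Bv; rewrite bform_sumr.
    apply: eq_bigr => w; rewrite inE => Bw; rewrite /cut_block Bv (negbTE Bw).
    by case: eqP => // vw; rewrite -vw Bv in Bw.
  have E2 : \sum_(v in ~: B) \sum_(w in B) bform (cut_block v w) (y v) (y w)
     = bform cross_block SB SA.
    rewrite -E1 exchange_big /=; apply: eq_bigr => v Bv; apply: eq_bigr => w Bw.
    by rewrite bformC // cut_blockC.
  rewrite splitB mulr2n mulrDl !mul1r -[X in _ + (X + _)]E1 -E2.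
  rewrite addrACA -!big_split; congr (_ + _); apply: eq_bigr => v Bv.
    rewrite splitB; congr (_ + _); apply: eq_bigr => w Bw.
    by rewrite /cut_block Bv Bw.
  rewrite splitB addrC; congr (_ + _); apply: eq_bigr => w.
  rewrite !inE in Bv *; move=> Bw.
  by rewrite /cut_block (negbTE Bv) (negbTE Bw).
have gB : (0 < #|B|)%N by apply: leq_trans b2.
have gA : (0 < #|~: B|)%N by apply: leq_trans leba.
have := bform_group gB psd_in (erefl SB).
have := bform_group gA psd_out (erefl SA).
rewrite -/a -/b.
have -> : a^-1 *: (1%:M - out_block) + out_block
    = a^-1 ^+ 2 *: ((a - b) *: const_mx 1 + b *: T).
  apply/matrixP => i j; rewrite !mxE; field; by rewrite a0 a1.
have -> : b^-1 *: (1%:M - in_block) + in_block = b^-1 *: T.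
  apply/matrixP => i j; rewrite !mxE; field; by rewrite b0 b1.
set X := (X in _ <= X -> _); set Y := (X in _ -> _ <= X -> _).
move=> leX leY.
(* With z the difference of the two means SA/a - SB/b, the lower bound obtained from Jensen equals
   (sA + sB)^2 / n + b (T(z, z) - (b/n) (sum of z)^2), and both summands are nonnegative. *)
have := overlap_kernel_mean (a^-1 *: SA - b^-1 *: SB) kerT.
rewrite -/b nE.
have -> : \sum_i (a^-1 *: SA - b^-1 *: SB) i 0
   = a^-1 * \sum_i SA i 0 - b^-1 * \sum_i SB i 0.
  rewrite !mulr_sumr -sumrB; apply: eq_bigr => i _; by rewrite !mxE.
move: leX leY; rewrite /cross_block !bform_lin !bform_const (bformC SA SB sT).
set sA := \sum_i SA i 0; set sB := \sum_i SB i 0.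
set tAA := bform T SA SA; set tBB := bform T SB SB; set tBA := bform T SB SA.
move=> leX leY leM.
have : 0 <= (a + b)^-1 * (sA + sB) ^+ 2.
  by rewrite mulr_ge0 ?sqr_ge0 // invr_ge0; move: b2R lebaR; lra.
have -> : (a + b)^-1 * (sA + sB) ^+ 2 =
   a^-1 ^+ 2 * ((a - b) * (sA * sA) + b * tAA) + b^-1 * tBB
    + 2 * (a^-1 * (sB * sA - tBA))
    - b * (a^-1 ^+ 2 * tAA - 2 * a^-1 * b^-1 * tBA + b^-1 ^+ 2 * tBB)
    + b * (b / (a + b) * (a^-1 * sA - b^-1 * sB) ^+ 2).
  field; by rewrite a0 b0 n0.
move=> H; apply: (le_trans H).
rewrite -[leRHS]/(Y + X + 2 * (a^-1 * (sB * sA - tBA))).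
have b0' : 0 < b by move: b2R; lra.
have : b * (b / (a + b) * (a^-1 * sA - b^-1 * sB) ^+ 2) <=
   b * (a^-1 ^+ 2 * tAA - 2 * a^-1 * b^-1 * tBA + b^-1 ^+ 2 * tBB).
  by rewrite ler_pM2l //; apply: (le_trans leM); rewrite le_eqVlt; apply/orP;
    left; apply/eqP; ring.
move: leX leY; lra.
Qed.

Lemma cut_solutionE v i w j :
  cut_solution (mxtens_index (v, i)) (mxtens_index (w, j))
    = n%:R^-1 * cut_block v w i j.
Proof. by rewrite mxE !mxtens_indexK. Qed.

Let n0R : n%:R != 0 :> R. Proof. by rewrite nE. Qed.

Lemma cut_solution_diag v i :
  cut_solution (mxtens_index (v, i)) (mxtens_index (v, i)) = n%:R^-1.
Proof. by rewrite cut_solutionE /cut_block eqxx mxE eqxx mulr1. Qed.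

(** Given v at position i, some vertex occupies position j. For v in B the blocks add up to I + (T -
    I) + (J - T) = J; for v outside, to I + b (J - T)/a + ((a - b) J + b T - a I)/a = J. *)
Lemma cut_block_sum v i j : \sum_w cut_block v w i j = 1.
Proof.
rewrite (bigD1 v) //= {1}/cut_block eqxx (bigID (mem B)) /=.
have card1 (G : {set 'I_n}) : v \in G ->
    #|[pred w | (w != v) && (w \in G)]|%:R = #|G|%:R - 1 :> R.
  move=> Gv; rewrite (cardsD1 v G) Gv natrD addrAC subrr add0r; congr (_ %:R).
  by apply: eq_card => w; rewrite !inE.
case: (boolP (v \in B)) => Bv.
  rewrite (eq_bigr (fun=> in_block i j)); last first.
    by move=> w /andP[wv Bw]; rewrite /cut_block eq_sym (negbTE wv) Bv Bw.
  rewrite [X in _ + (_ + X)](eq_bigr (fun=> cross_block i j)); last first.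
    by move=> w /andP[wv Bw]; rewrite /cut_block eq_sym (negbTE wv) Bv (negbTE
      Bw).
  rewrite !sumr_const -[in_block i j *+ _]mulr_natr
    -[cross_block i j *+ _]mulr_natr card1 // -/b.
  have -> : #|[pred w | (w != v) && (w \notin B)]| = #|~: B|.
    by apply: eq_card => w; rewrite !inE; case: eqP => //= ->; rewrite Bv.
  by rewrite -/a !mxE; field; rewrite a0 b1.
rewrite (eq_bigr (fun=> cross_block i j)); last first.
  by move=> w /andP[wv Bw]; rewrite /cut_block eq_sym (negbTE wv) (negbTE Bv)
    Bw.
rewrite [X in _ + (_ + X)](eq_bigr (fun=> out_block i j)); last first.
  move=> w /andP[wv Bw].
  by rewrite /cut_block eq_sym (negbTE wv) (negbTE Bv) (negbTE Bw).
rewrite !sumr_const -[out_block i j *+ _]mulr_natr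
  -[cross_block i j *+ _]mulr_natr.
have -> : #|[pred w | (w != v) && (w \in B)]| = #|B|.
  by apply: eq_card => w; rewrite !inE; case: eqP => //= ->;
    rewrite (negbTE Bv).
have -> : #|[pred w | (w != v) && (w \notin B)]|%:R = a - 1.
  rewrite -card1 ?inE //; congr (_ %:R).
  by apply: eq_card => w; rewrite !inE.
by rewrite -/b !mxE; field; rewrite a0 a1.
Qed.

Lemma cut_block_ge0 v w i j : 0 <= cut_block v w i j.
Proof.
have /andP[T0 T1] := T01 i j.
have d : (i == j)%:R <= T i j.
  by have [<-|_] := eqVneq i j; rewrite ?Tii.
rewrite /cut_block; case: ifP => _; first by rewrite mxE ler0n.
have hb : 0 <= (b - 1)^-1 by rewrite invr_ge0; move: b2R; lra.
have ha : 0 <= a^-1 by rewrite invr_ge0; move: b2R lebaR; lra.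
have ha1 : 0 <= (a * (a - 1))^-1.
  by rewrite invr_ge0 mulr_ge0 //; move: b2R lebaR; lra.
have cross : 0 <= cross_block i j.
  by rewrite !mxE mulr_ge0 // subr_ge0.
case: ifP => _; case: ifP => _ //; rewrite !mxE mulr_ge0 ?subr_ge0 //.
(* Only [out_block] is left. Its numerator is (a - b) + b - a = 0 on the diagonal, and a - b + b
   [T i j] elsewhere, where [b <= a] is used. *)
have [<-|_] := eqVneq i j; rewrite ?Tii /=; first by lra.
have : 0 <= b * T i j by rewrite mulr_ge0 //; move: b2R; lra.
move: lebaR; lra.
Qed.

Lemma cut_block_diag v w i j :
  (v == w) != (i == j) -> cut_block v w i j = 0.
Proof.
rewrite /cut_block; have [_|vw] := eqVneq v w.
  by rewrite mxE; case: (i == j).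
have [<-|//] := eqVneq i j => _.
by case: ifP => _; case: ifP => _; rewrite !mxE ?eqxx Tii ?subrr ?mulr0 //=;
  ring.
Qed.

Lemma cut_solution_feasible : sdp2_feasible cut_solution.
Proof.
split; split.
- by apply/matrixP => k l; rewrite !mxE cut_blockC -{1}sym_cut mxE.
- by move=> k l; rewrite mxE mulr_ge0 ?invr_ge0 ?ler0n ?cut_block_ge0.
- move=> x; rewrite -/(bform _ _ _) bformE big_mxtens.
  pose y v := \col_i x (mxtens_index (v, i)) 0.
  have -> : \sum_v \sum_i \sum_l cut_solution (mxtens_index (v, i)) l
       * (x (mxtens_index (v, i)) 0 * x l 0)
     = n%:R^-1 * \sum_v \sum_w bform (cut_block v w) (y v) (y w).
    rewrite mulr_sumr; apply: eq_bigr => v _.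
    under eq_bigr do rewrite big_mxtens.
    rewrite exchange_big mulr_sumr; apply: eq_bigr => w _ /=.
    rewrite bformE mulr_sumr; apply: eq_bigr => i _.
    rewrite mulr_sumr; apply: eq_bigr => j _.
    by rewrite cut_solutionE -mulrA; congr (_ * (_ * (_ * _))); rewrite mxE.
  by rewrite mulr_ge0 ?invr_ge0 ?ler0n ?cut_block_form_ge0.
- move=> j; rewrite mxtrace_mxtens.
  rewrite (eq_bigr (fun=> n%:R^-1)).
    by rewrite sumr_const card_ord -[LHS]mulr_natr mulVf.
  move=> v _; rewrite (bigD1 j) //= [X in _ + X]big1 ?addr0.
    rewrite (bigD1 v) //= [X in _ + X]big1 ?addr0.
      rewrite (bigD1 j) //= [X in _ + X]big1 ?addr0.
        by rewrite cut_solution_diag tensmxE !mxE !eqxx !mul1r.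
      by move=> i /negbTE ij; rewrite tensmxE !mxE ij andbF mulr0 mul0r.
    move=> w /negbTE wv; apply: big1 => i _.
    by rewrite tensmxE !mxE eq_sym wv !mul0r.
  move=> i /negbTE ij; apply: big1 => w _; apply: big1 => k _.
  by rewrite tensmxE !mxE ij mulr0 mul0r.
- move=> v; rewrite mxtrace_mxtens.
  rewrite (bigD1 v) //= [X in _ + X]big1 ?addr0; last first.
    move=> u /negbTE uv; apply: big1 => i _; apply: big1 => w _;
      apply: big1 => j _.
    by rewrite tensmxE !mxE uv !mul0r.
  rewrite (eq_bigr (fun=> n%:R^-1)).
    by rewrite sumr_const card_ord -[LHS]mulr_natr mulVf.
  move=> i _; rewrite (bigD1 v) //= [X in _ + X]big1 ?addr0.
    rewrite (bigD1 i) //= [X in _ + X]big1 ?addr0.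
      by rewrite cut_solution_diag tensmxE !mxE !eqxx !mul1r.
    by move=> j /negbTE ji; rewrite tensmxE !mxE eq_sym ji mulr0 mul0r.
  move=> w /negbTE wv; apply: big1 => j _.
  by rewrite tensmxE !mxE wv andbF !mul0r.
- rewrite mxtrace_mxtens; apply: big1 => v _; apply: big1 => i _.
  apply: big1 => w _; apply: big1 => j _.
  rewrite mxE !tensmxE cut_solutionE cut_blockC.
  (* The coefficient matrix of constraint (iii) vanishes wherever [v == w] and [j == i] have the
     same truth value; the solution vanishes at all other entries. *)
  have [E|/cut_block_diag ->] := eqVneq (v == w) (j == i);
    last by rewrite !mulr0.
  rewrite !mxE [i == j]eq_sym -E; case: (v == w) => /=;
    by rewrite ?(subrr, mulr0, mul0r, addr0, mulr1, mul1r).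
(* By [cut_block_sum], each of the n^3 triples of v and two positions contributes 1/n once w is
   summed out. *)
- rewrite mxtrace_mxtens (eq_bigr (fun=> n%:R)).
    by rewrite sumr_const card_ord -[LHS]mulr_natr expr2.
  move=> v _; rewrite (eq_bigr (fun=> 1)); first by rewrite sumr_const card_ord.
  move=> i _; rewrite exchange_big /= (eq_bigr (fun=> n%:R^-1)).
    by rewrite sumr_const card_ord -[LHS]mulr_natr mulVf.
  move=> j _; rewrite -[RHS]mulr1 -[X in _ = _ * X](cut_block_sum v j i)
    mulr_sumr.
  apply: eq_bigr => w _.
  by rewrite tensmxE cut_solutionE !mxE !mul1r cut_blockC.
Qed.

End CutSolution.

(** * The cycle with one position deleted *)

(** Deleting r from the (n+1)-cycle leaves a path. After renumbering, its edges are edges of the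
    n-cycle, so the value of a cyclic kernel on successive positions controls every edge that is
    charged. *)
Lemma lift_ordS (n : nat) (r : 'I_n.+1) (i j : 'I_n) :
  lift r j = ordS (lift r i) -> j = ordS i.
Proof.
move=> /(congr1 val) /= E; apply/val_inj => /=; move: E.
have := ltn_ord i; have := ltn_ord j; have := ltn_ord r; rewrite /bump.
case: (leqP r j) => rj; case: (leqP r i) => ri rn jn ilt /=;
  rewrite ?add1n ?add0n => E;
  (have [En|En] := eqVneq i.+1 n;
    [rewrite En modnn | rewrite (modn_small (_ : i.+1 < n)%N); last lia]);
  move: E; try (have -> : i.+2 = n.+1 by lia); rewrite ?modnn ?modn_small; lia.
Qed.

(** Each position has a successor and a predecessor. Only an inequality holds in general, because
    the two coincide when n is 1 or 2. *)
Lemma sum_ordS_eq (R : realType) (n : nat) :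
  \sum_(i < n) \sum_(j < n) ((j == ordS i) || (i == ordS j))%:R <= 2 * n%:R :>
    R.
Proof.
apply: (@le_trans _ _
  (\sum_(i < n) \sum_(j < n) ((j == ordS i)%:R + (i == ordS j)%:R))).
  apply: ler_sum => i _; apply: ler_sum => j _.
  by case: (_ == _); case: (_ == _); rewrite ?addr0 ?add0r // lerDl.
have E : \sum_(i < n) \sum_(j < n) (j == ordS i)%:R = n%:R :> R.
  rewrite (eq_bigr (fun=> 1)); first by rewrite sumr_const card_ord.
  move=> i _; rewrite (bigD1 (ordS i)) //= eqxx big1 ?addr0 // => j /negbTE ->
    //.
under eq_bigr do rewrite big_split.
by rewrite big_split /= E exchange_big /= E mulr2n mulrDl mul1r.
Qed.

Lemma sum_cycle_mx_col (R : realType) (n : nat) (r : 'I_n.+1) :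
  \sum_i cycle_mx R n.+1 (lift r i) r <= 2.
Proof.
apply: (@le_trans _ _ (\sum_i cycle_mx R n.+1 i r)).
  by rewrite [leRHS](bigD1_ord r) //= lerDr mxE ler0n.
apply: (@le_trans _ _ (\sum_i ((i == ord_pred r)%:R + (i == ordS r)%:R))).
  apply: ler_sum => i _; rewrite mxE.
  rewrite -[r == _](inj_eq (@ord_pred_inj _)) ordSK eq_sym.
  by case: (_ == _); case: (_ == _); rewrite ?addr0 ?add0r // lerDl.
rewrite big_split /=.
have E (k : 'I_n.+1) : \sum_i (i == k)%:R = 1 :> R.
  by rewrite (bigD1 k) //= eqxx big1 ?addr0 // => j /negbTE ->.
by rewrite !E.
Qed.

(** * Cut metrics: tours and the cost of the solution *)

Definition cut_metric (R : realType) (N : nat) (B : {set 'I_N}) : 'M[R]_N :=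
  \matrix_(i, j) ((i \in B) (+) (j \in B))%:R.

Lemma cut_metric_tsp (R : realType) (N : nat) (B : {set 'I_N}) :
  tsp_instance (cut_metric R B).
Proof.
split=> [i j|i j|i|i j k]; rewrite !mxE ?ler0n ?addbb //;
  first by rewrite addbC.
case: (i \in B) (j \in B) (k \in B) => -[] [] /=; lra.
Qed.

(** If no step of the tour crossed the cut, membership in B would be constant along the tour, hence
    on all vertices. A crossing step costs 1. *)
Lemma cut_metric_OPT_ge1 (R : realType) (N : nat) (B : {set 'I_N}) x y :
  x \in B -> y \notin B -> 1 <= OPT_TSP (cut_metric R B).
Proof.
case: N B x y => [|N] B x y; first by case: x.
move=> Bx By; rewrite /OPT_TSP; set t := [arg min_(_ < _) _]%O.
suff [i Bi] : exists i, (t i \in B) != (t (ordS i) \in B).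
  rewrite /tour_cost (bigD1 i) //= mxE.
  rewrite (_ : _ (+) _ = true); last by move: Bi; do 2!case: (_ \in B).
  by rewrite lerDl sumr_ge0 // => j _; rewrite mxE ler0n.
apply/existsP; apply: contraNT By => /existsPn const.
have tB k (kN : (k < N.+1)%N) : (t (Ordinal kN) \in B) = (t ord0 \in B).
  elim: k kN => [|k IH] kN; first by congr (t _ \in B); apply/val_inj.
  rewrite -(IH (ltnW kN)) (eqP (negbNE (const (Ordinal (ltnW kN))))).
  by congr (t _ \in B); apply/val_inj; rewrite /= modn_small.
have tB' z : (z \in B) = (t ord0 \in B).
  by rewrite -[z in LHS](permKV t); case: (t^-1%g z) => k kN; rewrite tB.
by rewrite tB' -(tB' x).
Qed.

(** In the Kronecker term, 2ab ordered pairs of vertices are separated, at most 2n ordered pairs of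
    positions are adjacent, the weight is 1/2 and the entry is (1 - t)/(na): the product is 2b(1 -
    t). In the diagonal term, [s] lies outside the cut set, so each of the b vertices of B pays 1/n
    at each of the at most two neighbours of [r]. *)
Lemma cut_solution_cost (R : realType) (n : nat) (r s : 'I_n.+1)
    (B : {set 'I_n}) (T : 'M[R]_n) (t : R) :
  overlap_kernel #|B| T -> (2 <= #|B|)%N -> (#|B| <= #|~: B|)%N ->
  (forall i, T i (ordS i) = t) ->
  \tr (sdp2_cost r s (cut_metric R (lift s @: B)) *m cut_solution B T)
    <= 2 * #|B|%:R * (1 - t) + 2 * #|B|%:R / n%:R.
Proof.
move=> kT b2 leba Tt; set D := cut_metric R _.
have [sT _ _ T01 _] := kT.
have DE v w : D (lift s v) (lift s w) = ((v \in B) (+) (w \in B))%:R.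
  by rewrite mxE !(mem_imset _ _ (@lift_inj _ s)).
have DsE v : D s (lift s v) = (v \in B)%:R.
  rewrite mxE (mem_imset _ _ (@lift_inj _ s)) (_ : (s \in _) = false) //.
  by apply/imsetP => -[w _ /eqP]; rewrite (negbTE (neq_lift s w)).
have a0 : 0 < #|~: B|%:R :> R by rewrite ltr0n; lia.
have nN : (0 < n)%N by have := cardsC B; rewrite card_ord; lia.
have n0 : 0 < n%:R :> R by rewrite ltr0n.
have cardE (G : {set 'I_n}) : \sum_v (v \in G)%:R = #|G|%:R :> R.
  by rewrite -sum1_card natr_sum [RHS]big_mkcond; apply: eq_bigr => v _;
    case: ifP.
have costE v i w j : sdp2_cost r s D (mxtens_index (v, i)) (mxtens_index (w, j))
    = ((v \in B) (+) (w \in B))%:R * (2^-1 * cycle_mx R n.+1 (lift r i) (lift r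
      j))
      + ((v == w) && (i == j))%:R * (cycle_mx R n.+1 (lift r i) r * (v \in
        B)%:R).
  rewrite /sdp2_cost mxE tensmxE [X in _ + X]mxE vecE; congr (_ * _ + _).
  - by rewrite -DE mxE [in LHS]mxE.
  - by rewrite !mxE.
  rewrite -[LHS]mulr_natl (inj_eq (can_inj (@mxtens_indexK _ _))) -pair_eqE.
  congr (_ * _); rewrite mxE big_ord1 -DsE; congr (_ * _); by rewrite !mxE.
rewrite mxtrace_mxtens.
under eq_bigr do under eq_bigr do under eq_bigr do under eq_bigr do
  rewrite costE mulrDl.
under eq_bigr do under eq_bigr do under eq_bigr do rewrite big_split /=.
under eq_bigr do under eq_bigr do rewrite big_split /=.
under eq_bigr do rewrite big_split /=.
rewrite big_split /=; apply: lerD.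
  (* The entry of the solution for two separated vertices at adjacent positions. *)
  set c := (n%:R^-1 * (#|~: B|%:R^-1 * (1 - t))).
  have c0 : 0 <= c.
    rewrite /c !mulr_ge0 ?invr_ge0 ?(ltW n0) ?(ltW a0) // subr_ge0.
    by rewrite -(Tt (Ordinal nN)); case/andP: (T01 (Ordinal nN) (ordS (Ordinal
      nN))).
  apply: (@le_trans _ _ ((\sum_v \sum_w ((v \in B) (+) (w \in B))%:R) *
    (2^-1 * c * (\sum_(i < n) \sum_(j < n) ((j == ordS i) || (i == ordS
      j))%:R)))).
    rewrite mulr_suml; apply: ler_sum => v _.
    rewrite exchange_big /= mulr_suml; apply: ler_sum => w _.
    rewrite mulrA mulr_sumr; apply: ler_sum => i _.
    rewrite mulr_sumr; apply: ler_sum => j _.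
    rewrite cut_solutionE.
    case vw : ((v \in B) (+) (w \in B)); last by rewrite !mul0r.
    have -> : cut_block B T w v = cross_block B T.
      rewrite /cut_block; case: eqP vw => [->|_]; first by rewrite addbb.
      by case: (v \in B) (w \in B) => -[].
    have [ij|ij] := boolP ((j == ordS i) || (i == ordS j)).
      have Tji : T j i = t by case/orP: ij => /eqP->; rewrite ?Tt // -sT mxE Tt.
      rewrite !mxE Tji /c; case: (_ || _);
        rewrite ?mulr1 ?mul1r ?mulr0 ?mul0r //.
      have := T01 j i; rewrite Tji => /andP[_ t1].
      by rewrite !mulr_ge0 ?invr_ge0 ?subr_ge0 // ltW.
    rewrite [cycle_mx _ _ _ _]mxE.
    (* Positions not adjacent in the n-cycle are not adjacent in the path either, so the cost
       coefficient is 0. *)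
    have -> : (lift r j == ordS (lift r i)) || (lift r i == ordS (lift r j)) =
      false.
      apply/negbTE; apply: contra ij => /orP[/eqP/lift_ordS->|/eqP/lift_ordS->];
      by rewrite eqxx ?orbT.
    by rewrite !(mulr0, mul0r).
  have -> : \sum_v \sum_w ((v \in B) (+) (w \in B))%:R = 2 * #|B|%:R * #|~:
    B|%:R :> R.
    have card_a : \sum_v (v \notin B)%:R = #|~: B|%:R :> R.
      by rewrite -cardE; apply: eq_bigr => v _; rewrite inE.
    transitivity (\sum_v ((v \in B)%:R * #|~: B|%:R + (v \notin B)%:R * #|B|%:R
      : R)).
      apply: eq_bigr => v _; case: (v \in B) => /=;
        by rewrite ?card_a ?cardE mul1r mul0r ?addr0 ?add0r.
    rewrite big_split /= -!mulr_suml card_a cardE; ring.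
  apply: (@le_trans _ _ (2 * #|B|%:R * #|~: B|%:R * (2^-1 * c * (2 * n%:R)))).
    apply: ler_wpM2l; first by rewrite !mulr_ge0.
    by apply: ler_wpM2l (sum_ordS_eq _ _); rewrite mulr_ge0.
  rewrite le_eqVlt; apply/orP; left; apply/eqP; rewrite /c; field.
  by rewrite !gt_eqF.
apply: (@le_trans _ _ (\sum_(v < n) (v \in B)%:R *
   ((\sum_(i < n) cycle_mx R n.+1 (lift r i) r) / n%:R))).
  apply: ler_sum => v _; rewrite mulr_suml mulr_sumr; apply: ler_sum => i _.
  rewrite (bigD1 v) //= [X in _ + X]big1 ?addr0; last first.
    by move=> w /negbTE wv; apply: big1 => j _; rewrite eq_sym wv !mul0r.
  rewrite (bigD1 i) //= [X in _ + X]big1 ?addr0; last first.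
    by move=> j /negbTE ji; rewrite [i == j]eq_sym ji andbF !mul0r.
  by rewrite !eqxx mul1r cut_solution_diag [cycle_mx _ _ _ _ * _]mulrC mulrA.
rewrite -mulr_suml cardE.
rewrite [2 * _]mulrC -mulrA ler_wpM2l // ler_wpM2r ?invr_ge0 ?(ltW n0) //.
exact: sum_cycle_mx_col.
Qed.

(** * Autocorrelations on the cycle *)

(** Subtraction is that of the integers modulo m + 1. Summing over the shift [t] exhibits a Gram
    matrix, from which positive semidefiniteness is read off. *)
Definition cyclic_corr (R : realType) (m : nat) (h : 'I_m.+1 -> R) : 'M[R]_m.+1
  :=
  \matrix_(i, j) \sum_t h (i - t) * h (j - t).

Section CyclicCorrelation.
Context {R : realType} {m : nat}.
Variable h : 'I_m.+1 -> R.

Lemma sum_cyclic (F : 'I_m.+1 -> R) i : \sum_t F (i - t) = \sum_k F k.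
Proof. by rewrite [RHS](reindex_inj (inv_inj (subKr i))). Qed.

Lemma ordS_sub (i t : 'I_m.+1) : ordS (i - t) = ordS i - t.
Proof.
have E (k : 'I_m.+1) : ordS k = k + inZp 1.
  by apply/val_inj; rewrite /= modnDmr addn1.
by rewrite !E addrAC.
Qed.

Lemma cyclic_corr_sym : (cyclic_corr h)^T = cyclic_corr h.
Proof.
by apply/matrixP => i j; rewrite !mxE; apply: eq_bigr => t _; rewrite mulrC.
Qed.

Lemma cyclic_corr_psd : psdmx (cyclic_corr h).
Proof.
move=> u; rewrite -/(bform _ _ _) bformE.
have -> : \sum_i \sum_j cyclic_corr h i j * (u i 0 * u j 0)
   = \sum_t (\sum_i h (i - t) * u i 0) ^+ 2.
  under eq_bigr do under eq_bigr do rewrite mxE mulr_suml.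
  under eq_bigr do rewrite exchange_big /=.
  rewrite exchange_big /=; apply: eq_bigr => t _.
  rewrite expr2 mulr_suml; apply: eq_bigr => i _.
  rewrite mulr_sumr; apply: eq_bigr => j _; ring.
by apply: sumr_ge0 => t _; rewrite sqr_ge0.
Qed.

Lemma cyclic_corr_diag i : cyclic_corr h i i = \sum_k h k ^+ 2.
Proof. by rewrite mxE -[RHS](sum_cyclic _ i). Qed.

Lemma cyclic_corr_succ i : cyclic_corr h i (ordS i) = \sum_k h k * h (ordS k).
Proof.
by rewrite mxE -[RHS](sum_cyclic _ i); apply: eq_bigr => t _; rewrite ordS_sub.
Qed.

Lemma cyclic_corr_sum i : \sum_j cyclic_corr h i j = (\sum_k h k) ^+ 2.
Proof.
under eq_bigr do rewrite mxE.
rewrite exchange_big /= expr2 -[X in X * _](sum_cyclic _ i) mulr_suml.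
apply: eq_bigr => t _; rewrite -mulr_sumr; congr (_ * _).
by rewrite [RHS](reindex_inj (addIr (- t))).
Qed.

Lemma cyclic_corr_le i j : cyclic_corr h i j <= \sum_k h k ^+ 2.
Proof.
have : 0 <= \sum_t (h (i - t) - h (j - t)) ^+ 2.
  by apply: sumr_ge0 => t _; rewrite sqr_ge0.
have -> : \sum_t (h (i - t) - h (j - t)) ^+ 2
   = 2 * \sum_k h k ^+ 2 - 2 * cyclic_corr h i j.
  rewrite mulr2n mulrDl !mul1r -{1}(sum_cyclic (fun k => h k ^+ 2) i).
  rewrite -(sum_cyclic (fun k => h k ^+ 2) j) mxE mulr_sumr -big_split -sumrB
    /=.
  by apply: eq_bigr => t _; ring.
lra.
Qed.

End CyclicCorrelation.

(** * The kernel of the parabolic bump *)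

(** Cauchy-Schwarz against the constant 1, by Lagrange's identity. For a bump supported on [L]
    positions it bounds the row sums of the normalised autocorrelation by [L]. *)
Lemma sqr_sum_le (R : realType) (L : nat) (h : 'I_L -> R) :
  (\sum_k h k) ^+ 2 <= L%:R * \sum_k h k ^+ 2.
Proof.
have : 0 <= \sum_k \sum_l (h k - h l) ^+ 2.
  by apply: sumr_ge0 => k _; apply: sumr_ge0 => l _; rewrite sqr_ge0.
have -> : \sum_k \sum_l (h k - h l) ^+ 2
   = 2 * (L%:R * \sum_k h k ^+ 2 - (\sum_k h k) ^+ 2).
  transitivity (\sum_k (L%:R * h k ^+ 2 + \sum_l h l ^+ 2 - 2 * h k * \sum_l h
    l)).
    apply: eq_bigr => k _.
    transitivity (\sum_l (h k ^+ 2 + h l ^+ 2 - 2 * h k * h l)).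
      by apply: eq_bigr => l _; ring.
    by rewrite !big_split /= sumrN sumr_const card_ord -mulr_sumr (mulr_natl (h
      k ^+ 2)).
  rewrite !big_split /= sumrN sumr_const card_ord -mulr_suml -!mulr_sumr.
  rewrite -[X in _ + X - _]mulr_natl; ring.
lra.
Qed.

(** The parameter [x] is kept apart from [M] so that the induction on [M] goes through; at x = M = L
    the right-hand side is L^5 - L. *)
Lemma sum_parabola_sqr (R : realType) (M : nat) (x : R) :
  30 * \sum_(k < M) (k%:R * (x - k%:R)) ^+ 2 =
  5 * x ^+ 2 * (M%:R - 1) * M%:R * (2 * M%:R - 1)
  - 15 * x * (M%:R * (M%:R - 1)) ^+ 2
  + M%:R * (M%:R - 1) * (2 * M%:R - 1) * (3 * M%:R ^+ 2 - 3 * M%:R - 1).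
Proof.
elim: M => [|M IH]; first by rewrite big_ord0; ring.
by rewrite big_ord_recr /= mulrDr IH -[M.+1%:R]natr1; ring.
Qed.

(** The autocorrelation of the bump, divided by its diagonal value [H], has all properties but the
    row sum, which is [S <= L]. Mixing it with the all-ones matrix raises the row sum to [L] and
    only brings successive entries closer to 1. *)
Lemma overlap_kernel_exists (R : realType) (L m : nat) :
  (2 <= L)%N -> (L < m.+1)%N ->
  exists T : 'M[R]_m.+1, exists t : R,
    [/\ overlap_kernel L T, forall i, T i (ordS i) = t
      & 1 - t <= 30 / L%:R ^+ 2].
Proof.
(* Truncated subtraction makes [h] vanish from [L] on. *)
move=> L2 Lm; pose h (k : 'I_m.+1) : R := (k * (L - k))%:R.
have h0 k : 0 <= h k by rewrite ler0n.
pose H := \sum_k h k ^+ 2; pose S := (\sum_k h k) ^+ 2 / H.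
have big_L (F : nat -> R) : (forall k, (L <= k)%N -> F k = 0) ->
    \sum_(k < m.+1) F k = \sum_(k < L) F k.
  move=> F0; rewrite (big_ord_widen m.+1 F (ltnW Lm)) [RHS]big_mkcond /=.
  by apply: eq_bigr => k _; case: ltnP => // /F0.
have hL k : (L <= k)%N -> (k * (L - k))%:R = 0 :> R.
  by move=> Lk; rewrite (eqP (Lk : L - k == 0)%N) muln0.
have LR : 2 <= L%:R :> R by rewrite ler_nat.
have HE : 30 * H = L%:R ^+ 5 - L%:R.
  rewrite /H (big_L (fun k => (k * (L - k))%:R ^+ 2)); last first.
    by move=> k /hL ->; rewrite expr0n.
  rewrite (eq_bigr (fun k : 'I_L => (k%:R * (L%:R - k%:R)) ^+ 2)).
    by rewrite sum_parabola_sqr; ring.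
  by move=> k _; rewrite natrM natrB // ltnW.
have L4 : 16 <= L%:R ^+ 4 :> R.
  have -> : 16 = 2 ^+ 4 :> R by ring.
  by apply: lerXn2r => //; rewrite nnegrE; lra.
have HL : L%:R ^+ 5 <= 60 * H.
  have -> : 60 * H = 2 * (L%:R ^+ 5 - L%:R) by rewrite -HE; ring.
  have : 0 <= L%:R * (L%:R ^+ 4 - 2) :> R by rewrite mulr_ge0 //; lra.
  have -> : L%:R * (L%:R ^+ 4 - 2) = 2 * (L%:R ^+ 5 - L%:R) - L%:R ^+ 5 :> R by
    ring.
  by rewrite subr_ge0.
have L5 : 0 < L%:R ^+ 5 :> R by rewrite exprn_gt0 //; lra.
have H0 : 0 < H by lra.
have SL : S <= L%:R.
  rewrite ler_pdivrMr // /H (big_L (fun k => (k * (L - k))%:R)) //.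
  rewrite (big_L (fun k => (k * (L - k))%:R ^+ 2)); first exact: sqr_sum_le.
  by move=> k /hL ->; rewrite expr0n.
have Ln : L%:R < m.+1%:R :> R by rewrite ltr_nat.
(* The solution of c S + (1 - c)(m + 1) = L. *)
pose c := (m.+1%:R - L%:R) / (m.+1%:R - S).
have c0 : 0 <= c by rewrite divr_ge0 //; lra.
have c1 : c <= 1 by rewrite ler_pdivrMr ?mul1r; lra.
pose q := H^-1 *: cyclic_corr h.
pose T := c *: q + (1 - c) *: const_mx 1.
have q01 i j : 0 <= cyclic_corr h i j / H <= 1.
  rewrite ler_pdivrMr // mul1r cyclic_corr_le andbT divr_ge0 ?(ltW H0) //.
  by rewrite mxE sumr_ge0 // => t _; rewrite mulr_ge0.
have TE i j : T i j = c * (cyclic_corr h i j / H) + (1 - c).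
  rewrite mxE [X in X + _]mxE [X in _ + X]mxE [q _ _]mxE.
  by rewrite [const_mx _ _ _]mxE mulr1 [_ / H]mulrC.
have succE i : T i (ordS i) = c * ((\sum_k h k * h (ordS k)) / H) + (1 - c).
  by rewrite TE cyclic_corr_succ.
exists T, (c * ((\sum_k h k * h (ordS k)) / H) + (1 - c)); split=> //.
  split=> [||i|i j|i].
  - by rewrite /T /q [in LHS]linearD ![in LHS]linearZ /= cyclic_corr_sym
    trmx_const.
  - apply: psdmxD.
      do 2!apply: psdmxZ => //; first by rewrite invr_ge0 ltW.
      exact: cyclic_corr_psd.
    apply: psdmxZ; first by rewrite subr_ge0.
    by move=> u; rewrite -/(bform _ _ _) bform_const -expr2 sqr_ge0.
  - by rewrite TE cyclic_corr_diag divff ?gt_eqF //; ring.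
  - have /andP[q0 q1] := q01 i j.
    rewrite TE; have : 0 <= c * (cyclic_corr h i j / H) by rewrite mulr_ge0.
    have : c * (cyclic_corr h i j / H) <= c by rewrite ler_piMr.
    lra.
  - under eq_bigr do rewrite TE.
    rewrite big_split /= -mulr_sumr -mulr_suml cyclic_corr_sum -/S.
    rewrite sumr_const card_ord -[(1 - c) *+ _]mulr_natr /c; field.
    by apply/lt0r_neq0; lra.
set X := \sum_k _.
have XH : H - X <= L%:R ^+ 3 / 2.
  have : \sum_(k < m.+1) (h k - h (ordS k)) ^+ 2 <= L%:R ^+ 3.
    (* On the support the increment of [h] is L - 2k - 1, at most [L] in absolute value. Since
       [L < m.+1], the wrap-around step joins two zeros of [h]. *)
    pose F k : R := if (k < L)%N then L%:R ^+ 2 else 0.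
    apply: (@le_trans _ _ (\sum_(k < m.+1) F k)).
      apply: ler_sum => k _; rewrite /F /h /=.
      have [kL|kL] := ltnP k L; last first.
        rewrite hL // sub0r sqrrN; case: (eqVneq k.+1 m.+1) => [->|km].
          by rewrite modnn mul0n expr0n.
        rewrite modn_small; first by rewrite hL ?expr0n // ltnW.
        by rewrite ltn_neqAle km ltn_ord.
      rewrite modn_small; last by apply: leq_ltn_trans Lm.
      rewrite natrM natrB; last exact: ltnW.
      rewrite [(k.+1 * _)%:R]natrM natrB // -[k.+1%:R]natr1.
      have kR : k%:R + 1 <= L%:R :> R by rewrite natr1 ler_nat.
      have k0 : 0 <= k%:R :> R by rewrite ler0n.
      rewrite -subr_ge0.
      have -> : L%:R ^+ 2 - (k%:R * (L%:R - k%:R) -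
         (k%:R + 1) * (L%:R - (k%:R + 1))) ^+ 2
         = (2 * k%:R + 1) * (2 * L%:R - 2 * k%:R - 1) :> R by ring.
      by rewrite mulr_ge0 //; lra.
    rewrite big_L => [|k Lk]; last by rewrite /F ltnNge Lk.
    rewrite (eq_bigr (fun=> L%:R ^+ 2)) => [|k _]; last by rewrite /F ltn_ord.
    by rewrite sumr_const card_ord -[_ *+ L]mulr_natr -exprSr.
  have -> : \sum_k (h k - h (ordS k)) ^+ 2 = 2 * (H - X).
    have HS : \sum_k h (ordS k) ^+ 2 = H.
      by rewrite [RHS](reindex_inj (@ordS_inj _)).
    transitivity (H + \sum_k h (ordS k) ^+ 2 - 2 * X); last by rewrite HS; ring.
    rewrite /H /X mulr_sumr -big_split -sumrB /=.
    by apply: eq_bigr => k _; ring.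
  lra.
have XH' : X <= H.
  have := cyclic_corr_le h ord0 (ordS ord0).
  by rewrite cyclic_corr_succ.
apply: (@le_trans _ _ ((H - X) / H)).
  have -> : 1 - (c * (X / H) + (1 - c)) = c * ((H - X) / H).
    by field; rewrite gt_eqF.
  by rewrite ler_piMl // divr_ge0 ?subr_ge0 // ltW.
(* The constant 30 comes from H - X <= L^3 / 2 and H >= L^5 / 60. *)
rewrite ler_pdivrMr // mulrAC ler_pdivlMr ?exprn_gt0 //; last by lra.
apply: (@le_trans _ _ (L%:R ^+ 3 / 2 * L%:R ^+ 2)).
  by rewrite ler_wpM2r // exprn_ge0 //; lra.
have -> : L%:R ^+ 3 / 2 * L%:R ^+ 2 = L%:R ^+ 5 / 2 :> R by field.
lra.
Qed.

(** * The bad instances and the unbounded ratio *)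

Lemma sdp2_cost_ge0 (R : realType) (n : nat) (r s : 'I_n.+1) (D : 'M[R]_n.+1)
    k l :
  (forall i j, 0 <= D i j) -> 0 <= sdp2_cost r s D k l.
Proof.
move=> D0; rewrite -(mxtens_unindexK k) -(mxtens_unindexK l).
case: (mxtens_unindex k) (mxtens_unindex l) => v i [w j].
rewrite /sdp2_cost mxE tensmxE [X in _ + X]mxE vecE addr_ge0 //.
  by rewrite !mxE !mulr_ge0.
by rewrite mulrn_wge0 // mxE big_ord1 !mxE mulr_ge0.
Qed.

Lemma OPT_SDP2_ge0 (R : realType) (n : nat) (r s : 'I_n.+1) (D : 'M[R]_n.+1) :
  (forall i j, 0 <= D i j) -> (0 <= OPT_SDP2 r s D)%E.
Proof.
move=> D0; apply: le_ereal_inf_tmp => _ [Y [[_ Y0 _] _] <-].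
rewrite lee_fin; apply: sumr_ge0 => k _; rewrite mxE; apply: sumr_ge0 => l _.
by rewrite mulr_ge0 ?sdp2_cost_ge0.
Qed.

(** With |B| = L and n = 2 L^2 + 1 positions, the two cost terms are at most 2L (30 / L^2) = 60 / L
    and 2L / n <= 1 / L. *)
Lemma cut_instance_gap (R : realType) (L : nat) (r s : 'I_(2 * L ^ 2).+2) :
  (2 <= L)%N ->
  exists D : 'M[R]_((2 * L ^ 2).+2),
    [/\ tsp_instance D, 1 <= OPT_TSP D & (OPT_SDP2 r s D <= (61 / L%:R)%:E)%E].
Proof.
move=> L2; set m := (2 * L ^ 2)%N in r s *.
have Lm : (2 * L < m.+1)%N by rewrite ltnS leq_mul2l /= -[leqLHS]expn1
  leq_exp2l.
pose B := [set v : 'I_m.+1 | (v < L)%N].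
have cardB : #|B| = L.
  rewrite -sum1dep_card -(big_ord_widen _ (fun=> 1%N)); last by lia.
  by rewrite sum1_card card_ord.
have cardA : #|~: B| = (m.+1 - L)%N.
  by have := cardsC B; rewrite card_ord cardB; lia.
exists (cut_metric R (lift s @: B)); split; first exact: cut_metric_tsp.
  apply: (@cut_metric_OPT_ge1 _ _ _ (lift s ord0) s).
    by rewrite (mem_imset _ _ (@lift_inj _ s)) inE /=; lia.
  by apply/imsetP => -[w _ /eqP]; rewrite (negbTE (neq_lift s w)).
have [|T [t [kT Tt t1]]] := @overlap_kernel_exists R L m L2; first by lia.
rewrite -{1}cardB in kT.
have bB : (2 <= #|B|)%N by rewrite cardB.
have bA : (#|B| <= #|~: B|)%N by rewrite cardB cardA; lia.
apply: ge_ereal_inf; exists (\tr (sdp2_cost r s (cut_metric R (lift s @: B))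
   *m cut_solution B T))%:E.
  by exists (cut_solution B T) => //; apply: cut_solution_feasible.
rewrite lee_fin; apply: (le_trans (cut_solution_cost _ _ kT bB bA Tt)).
rewrite cardB.
have L0 : 0 < L%:R :> R by rewrite ltr0n; lia.
have -> : 61 / L%:R = 2 * L%:R * (30 / L%:R ^+ 2) + 1 / L%:R :> R.
  by field; rewrite gt_eqF.
apply: lerD; first by rewrite ler_wpM2l // mulr_ge0 // ltW.
rewrite ler_pdivrMr ?ltr0n // mulrAC ler_pdivlMr // mul1r -!natrM ler_nat /m.
by rewrite -mulnA -[(L * L)%N]/(L ^ 2)%N leqnSn.
Qed.

Theorem corollary4p2 (R : realType) (r s : forall n : nat, 'I_n.+1) :
  sdp2_integrality_gap R r s = +oo%E.
Proof.
apply: eq_infty => x.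
(* The ratio will be at least L / 61; adding 2 ensures [2 <= L]. *)
pose L := (Num.Def.archi_bound (61 * `|x|)).+2.
have xL : 61 * x <= L%:R.
  apply: (@le_trans _ _ (61 * `|x|)); first by rewrite ler_pM2l ?ler_norm.
  apply: (le_trans (ltW (archi_boundP _))); first by rewrite mulr_ge0.
  by rewrite ler_nat; lia.
have L0 : 0 < L%:R :> R by rewrite ltr0n.
pose n := (2 * L ^ 2).+1.
have [D [tspD OPT1 SDPle]] := @cut_instance_gap R L (r n) (s n) isT.
have SDP0 : (0 <= OPT_SDP2 (r n) (s n) D)%E by apply: OPT_SDP2_ge0; case: tspD.
apply: le_ereal_sup_tmp; exists ((OPT_TSP D)%:E / OPT_SDP2 (r n) (s n) D)%E.
  exists n, D; split=> //.
  by rewrite gt_eqF // (lt_le_trans ltr01).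
apply: (@le_trans _ _ (L%:R / 61)%:E).
  by rewrite lee_fin ler_pdivlMr // mulrC.
(* Inversion in [\bar R] reverses the order of nonnegative values and sends 0 to [+oo], so a
   vanishing optimum of the program needs no separate case. *)
apply: (@le_trans _ _ (OPT_SDP2 (r n) (s n) D)^-1%E).
  rewrite -[(L%:R / 61)%R]invrK invf_div.
  have -> : ((61 / L%:R)^-1)%:E = ((61 / L%:R)%:E)^-1%E :> \bar R.
    by rewrite inver gt_eqF // divr_gt0.
  by rewrite lee_pV2 // inE lee_fin ltW // divr_gt0.
rewrite -[leLHS]mul1e lee_wpmul2r ?inve_ge0 ?lee_fin //.
Qed.
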